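(* Let $n\ge 2$ be an integer and let $\delta\in[0,1)$. Then $\delta$ is $n$-far if and only if $T(\delta)<\infty$. Moreover, if $\delta$ is $n$-far, then $$\frac{1}{n^{T(\delta)+1}}\le C(\delta)\le\frac{1}{n^{T(\delta)}}.$$
   Context: Fix an integer $n\ge 2$. Far numbers: let $\Sigma$ be the set of pairs of integers $(m,k)$ with either $m\ge 0$, $k\in\mathbb{Z}$, or $m<0$, $k\ne 0$. A real number $\delta$ is $n$-far if there is $C>0$ (possibly depending on $\delta$ but not on $m,k$) with $$\left|\delta-\frac{k}{n^m}\right|\ge\frac{C}{n^m}\quad\text{for all }(m,k)\in\Sigma.$$ For an $n$-far $\delta$, $C(\delta)$ denotes the best (largest) such constant, i.e. $C(\delta)=\inf_{(m,k)\in\Sigma}n^m\left|\delta-\frac{k}{n^m}\right|$. Base-$n$ representation: for $\delta\in[0,1)$ write $\delta=\sum_{i=1}^\infty\frac{a_i}{n^i}$ with $a_i\in\{0,1,\dots,n-1\}$, where $(a_i)$ is chosen to be the finest such representation: if $\delta=\sum_{i\ge1}b_i/n^i$ is another base-$n$ representation, then there is $i_0$ with $a_i=b_i$ for $i<i_0$ and $a_{i_0}>b_{i_0}$. Ties: if for some $i_2\ge i_1\ge 1$ the digits satisfy $a_{i_1}=a_{i_1+1}=\dots=a_{i_2}=0$, or $a_{i_1}=a_{i_1+1}=\dots=a_{i_2}=n-1$, then $(a_{i_1},\dots,a_{i_2})$ is called a tie. Define $$T(\delta):=\sup\{\,i_2-i_1+1:\ (a_{i_1},\dots,a_{i_2})\text{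 is a tie}\,\}\in\{0,1,2,\dots\}\cup\{\infty\},$$ the supremum of the lengths of all ties, with $T(\delta)=0$ if there are no ties. *)

(* Defs.v *)
From HB Require Import structures.
From mathcomp Require Import all_boot all_order all_algebra.
From mathcomp Require Import all_classical all_reals all_analysis.

Set Implicit Arguments.
Unset Strict Implicit.
Unset Printing Implicit Defensive.

Import Order.TTheory GRing.Theory Num.Theory.
Import numFieldNormedType.Exports.

Local Open Scope classical_set_scope.
Local Open Scope ring_scope.

Definition Sigma : set (int * int) :=
  [set mk | 0 <= mk.1 \/ (mk.1 < 0 /\ mk.2 != 0)].

Definition is_far (R : realType) (n : nat) (delta : R) : Prop :=
  exists2 C : R, 0 < C &
    forall m k : int, Sigma (m, k) ->
      C / n%:R ^ m <= `|delta - k%:~R / n%:R ^ m|.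

(* The set is nonempty and bounded below by 0, so [inf] is the true infimum. *)
Definition far_const (R : realType) (n : nat) (delta : R) : R :=
  inf [set n%:R ^ mk.1 * `|delta - mk.2%:~R / n%:R ^ mk.1| | mk in Sigma].

(* Digit sequences are indexed from 0: [a i] is the coefficient of n^-(i+1). *)
Definition base_repr (R : realType) (n : nat) (delta : R) (a : nat -> nat) :
    Prop :=
  (forall i, (a i < n)%N) /\
  [series (a i)%:R / n%:R ^+ i.+1 : R]_i @ \oo --> delta.

Definition finest_repr (R : realType) (n : nat) (delta : R) (a : nat -> nat) :
    Prop :=
  base_repr n delta a /\
  forall b : nat -> nat, base_repr n delta b -> b <> a ->
    exists i0 : nat, (forall i, (i < i0)%N -> a i = b i) /\ (b i0 < a i0)%N.

(* [finest_repr n delta] has at most one element by antisymmetry; [get] returns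
   it when it exists, which is the case for n >= 2 and 0 <= delta < 1. *)
Definition digits (R : realType) (n : nat) (delta : R) : nat -> nat :=
  get (finest_repr n delta).

Definition is_tie (n : nat) (a : nat -> nat) (i1 i2 : nat) : Prop :=
  (i1 <= i2)%N /\
  ((forall i, (i1 <= i <= i2)%N -> a i = 0%N) \/
   (forall i, (i1 <= i <= i2)%N -> a i = n.-1)).

(* [ereal_sup set0 = -oo], so the maximum with 0 gives the value 0 when there
   are no ties and changes nothing otherwise. *)
Definition tie_sup (R : realType) (n : nat) (delta : R) : \bar R :=
  maxe 0%E (ereal_sup
    [set l | exists i1 i2 : nat,
       is_tie n (digits n delta) i1 i2 /\ l = (i2 - i1 + 1)%:R%:E]).

(* Main.v *)
Require Import Defs.
From HB Require Import structures.
From mathcomp Require Import all_boot all_order all_algebra.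
From mathcomp Require Import all_classical all_reals all_analysis.
From mathcomp Require Import zify ring lra.

(** Multiplying by n^m turns the inequalities that define a far number into
    statements about the orbit of delta under multiplication by n: C(delta) is
    the infimum of the distances |n^m delta - k|.

    For m >= 0 the fractional part of n^m delta is 0.a_(m+1) a_(m+2) ... in base
    n.  Its first L digits form an integer w with
      w <= n^L (n^m delta - p) <= w + 1,
    where p is the integer formed by the first m digits of delta
    ([base_repr_window]).  This window touches the integer p exactly when w = 0,
    i.e. when the L digits vanish, and the integer p + 1 exactly when
    w = n^L - 1, i.e. when they all equal n - 1.  Hence a tie of length L brings
    n^m delta within n^-L of an integer ([tie_gap]); and when all ties have
    length at most T, no window of length T + 1 is a tie, so n^m delta stays at
    distance at least n^-(T+1) from the integers ([no_tie_gap]).  For m < 0 and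
    k <> 0 the distance to k is at least 1 - 1/n >= 1/n, since n^m delta lies in
    [0, 1/n].

    These estimates hold for any digits that represent delta.  They apply to
    [digits n delta], which is chosen as a finest representation, because one
    exists: the greedy digits, read off the integer parts of n^N delta, form one
    ([greedy_finest_repr]).  Finally T(delta), when finite, is a supremum of natural numbers, hence attained
    ([tie_sup_attained]), so the two bounds apply with T = T(delta). *)

Set Implicit Arguments.
Unset Strict Implicit.
Unset Printing Implicit Defensive.

Import Order.TTheory GRing.Theory Num.Theory.
Import numFieldNormedType.Exports.

Local Open Scope classical_set_scope.
Local Open Scope ring_scope.

(** * Integers written in base n *)

Fixpoint digit_val (n : nat) (a : nat -> nat) (N : nat) : nat :=
  if N is N'.+1 then (digit_val n a N' * n + a N')%N else 0%N.

(** Reading a block of m + L digits as m digits followed by L digits; the second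
    block is what describes the orbit of delta after m multiplications by n. *)
Lemma digit_valD n a m L :
  digit_val n a (m + L) =
  (digit_val n a m * n ^ L + digit_val n (fun i => a (m + i)) L)%N.
Proof.
elim: L => [|L IHL]; first by rewrite addn0 expn0 muln1 addn0.
by rewrite addnS /= IHL expnSr mulnDl mulnA addnA.
Qed.

Lemma eq_digit_val n a b N :
  (forall i, (i < N)%N -> a i = b i) -> digit_val n a N = digit_val n b N.
Proof.
elim: N => //= N IHN ab.
by rewrite IHN ?ab // => i iN; apply: ab; rewrite ltnS ltnW.
Qed.

Lemma ltn_digit_val n a N :
  (forall i, (a i < n)%N) -> (digit_val n a N < n ^ N)%N.
Proof.
move=> an; elim: N => //= N IHN; rewrite expnSr.
have := an N; nia.
Qed.

Lemma digit_val_eq0 n a N : (0 < n)%N ->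
  digit_val n a N = 0%N <-> forall i, (i < N)%N -> a i = 0%N.
Proof.
move=> n0; elim: N => [|N IHN] /=; first by [].
split=> [/eqP|a0].
  rewrite addn_eq0 muln_eq0 => /andP[/orP[/eqP v0|/eqP n0']] /eqP aN0 i; last first.
    by move: n0; rewrite n0'.
  rewrite ltnS leq_eqVlt => /orP[/eqP->//|]; exact: IHN.1.
have -> : digit_val n a N = 0%N by apply/IHN => i iN; apply: a0; lia.
by rewrite a0.
Qed.

(** Stated with a successor rather than with [n ^ N - 1], so that it matches
    the upper end of the window in [base_repr_window]. *)
Lemma digit_val_eq_max n a N : (forall i, (a i < n)%N) ->
  (digit_val n a N).+1 = (n ^ N)%N <-> forall i, (i < N)%N -> a i = n.-1.
Proof.
move=> an; elim: N => [|N IHN] /=; first by rewrite expn0.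
rewrite expnSr; have aN := an N; have vN := ltn_digit_val N an.
split=> [E i|amax].
  have [v aE] : (digit_val n a N).+1 = (n ^ N)%N /\ a N = n.-1 by split; nia.
  rewrite ltnS leq_eqVlt => /orP[/eqP->//|]; exact: IHN.1.
have v : (digit_val n a N).+1 = (n ^ N)%N.
  by apply/IHN => i iN; apply: amax; lia.
have := amax N (ltnSn N); nia.
Qed.

(** * Digit windows of a base-n representation *)

Section Expansion.
Variables (R : realType) (n : nat).
Hypothesis hn : (2 <= n)%N.

Let n_gt0 : 0 < n%:R :> R. Proof. by rewrite ltr0n; lia. Qed.
Let nX_gt0 N : 0 < n%:R ^+ N :> R. Proof. exact: exprn_gt0. Qed.

Lemma series_digit_val (a : nat -> nat) N :
  [series (a i)%:R / n%:R ^+ i.+1 : R]_i N = (digit_val n a N)%:R / n%:R ^+ N.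
Proof.
elim: N => [|N IHN]; first by rewrite seriesEnat /= big_geq // mul0r.
rewrite seriesEnat /= big_nat_recr //=; move: IHN; rewrite seriesEnat /= => ->.
have := nX_gt0 N; have := n_gt0; rewrite natrD natrM exprS => ? ?.
by field; rewrite !gt_eqF.
Qed.

(** The digits after the N-th contribute between 0 and n^-N to delta, the upper
    bound being the value of a tail of digits all equal to n - 1.  That tail may
    occur, so the second inequality cannot be made strict for an arbitrary
    representation. *)
Lemma base_repr_bounds (delta : R) (a : nat -> nat) N :
  base_repr n delta a ->
  (digit_val n a N)%:R <= n%:R ^+ N * delta <= (digit_val n a N).+1%:R.
Proof.
move=> [an adelta].
have scale M : (N <= M)%N ->
    n%:R ^+ N * [series (a i)%:R / n%:R ^+ i.+1 : R]_i M =
    (digit_val n a N)%:R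
      + (digit_val n (fun i => a (N + i)%N) (M - N))%:R / n%:R ^+ (M - N).
  move=> NM; rewrite series_digit_val -{1 2}(subnKC NM) digit_valD.
  rewrite natrD natrM natrX exprD.
  have := nX_gt0 N; have := nX_gt0 (M - N) => ? ?.
  by field; rewrite !gt_eqF.
have scvg : (n%:R ^+ N * [series (a i)%:R / n%:R ^+ i.+1 : R]_i M) @[M --> \oo]
    --> n%:R ^+ N * delta by exact: cvgMl_tmp.
rewrite -(cvg_lim _ scvg) //; apply/andP; split.
  apply: limr_ge; first by apply/cvg_ex; eexists; exact: scvg.
  near=> M; rewrite scale; last by near: M; exact: nbhs_infty_ge.
  by rewrite lerDl divr_ge0 // ltW.
apply: limr_le; first by apply/cvg_ex; eexists; exact: scvg.
near=> M; rewrite scale; last by near: M; exact: nbhs_infty_ge.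
rewrite -natr1 lerD2l ler_pdivrMr // mul1r -natrX ler_nat ltnW //.
by apply: ltn_digit_val.
Unshelve. all: by end_near. Qed.

(** The bounds for m + L digits, rescaled to the fractional part of n^m delta.
    The distances from n^m delta to the integers are read off this window. *)
Lemma base_repr_window (delta : R) (a : nat -> nat) m L :
  base_repr n delta a ->
  (digit_val n (fun i => a (m + i)%N) L)%:R
    <= n%:R ^+ L * (n%:R ^+ m * delta - (digit_val n a m)%:R)
    <= (digit_val n (fun i => a (m + i)%N) L).+1%:R.
Proof.
set w := digit_val n _ L => ha; have := base_repr_bounds (m + L) ha.
rewrite digit_valD -/w -addnS !natrD natrM natrX.
by rewrite mulrBr mulrA -exprD [(L + m)%N]addnC lerBrDl lerBlDl mulrC.
Qed.

(** * Existence of the finest representation *)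

(** The integer part of n^(i+1) delta modulo n, written as the difference of
    consecutive integer parts so that their telescoping with [digit_val] is
    immediate. *)
Definition greedy_digits (delta : R) (i : nat) : nat :=
  (Num.truncn (n%:R ^+ i.+1 * delta) - Num.truncn (n%:R ^+ i * delta) * n)%N.

Section Greedy.
Variables (delta : R).
Hypothesis hdelta : 0 <= delta < 1.

Let q N := Num.truncn (n%:R ^+ N * delta).

Let qP N : (q N)%:R <= n%:R ^+ N * delta < (q N).+1%:R.
Proof.
have /andP[delta0 _] := hdelta.
by apply: truncn_itv; rewrite mulr_ge0 // ltW.
Qed.

Let q_step N : (q N * n <= q N.+1 < (q N).+1 * n)%N.
Proof.
have /andP[l1 u1] := qP N; have /andP[l2 u2] := qP N.+1.
rewrite exprS -mulrA in l2 u2.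
apply/andP; split.
  rewrite -ltnS -(ltr_nat R) (le_lt_trans _ u2) // natrM mulrC.
  by rewrite ler_wpM2l // ltW.
rewrite -(ltr_nat R) (le_lt_trans l2) // natrM [ltRHS]mulrC.
by rewrite ltr_pM2l.
Qed.

Lemma digit_val_greedy N : digit_val n (greedy_digits delta) N = q N.
Proof.
elim: N => [|N IHN] /=.
  by apply/esym/truncn_def; rewrite expr0 mul1r; exact: hdelta.
by rewrite IHN /greedy_digits -!/(q _); have := q_step N; lia.
Qed.

Lemma greedy_base_repr : base_repr n delta (greedy_digits delta).
Proof.
split=> [i|].
  by rewrite /greedy_digits -!/(q _); have := q_step i; rewrite mulSn; lia.
have -> : [series (greedy_digits delta i)%:R / n%:R ^+ i.+1 : R]_i =
    (fun N => (q N)%:R / n%:R ^+ N).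
  by apply/funext => N; rewrite series_digit_val digit_val_greedy.
apply: (@squeeze_cvgr _ _ _ _ (fun N => delta - n%:R^-1 ^+ N) (fun=> delta)).
- near=> N; have /andP[l u] := qP N.
  rewrite exprVn lerBlDr -[X in _ + X]mul1r -mulrDl natr1.
  by rewrite ler_pdivlMr // ler_pdivrMr // mulrC l ltW.
- rewrite -[X in _ --> X]subr0; apply: cvgB; first exact: cvg_cst.
  apply: cvg_expr; rewrite ger0_norm ?invr_ge0 // invf_lt1 // ltr1n; lia.
- exact: cvg_cst.
Unshelve. all: by end_near. Qed.

(** At the first index where another representation differs from the greedy one,
    its digit cannot be larger: its truncation would already be at least
    (floor (n^N delta) + 1) / n^N, which exceeds delta. *)
Lemma greedy_finest_repr : finest_repr n delta (greedy_digits delta).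
Proof.
split=> [|b hb ba]; first exact: greedy_base_repr.
set a := greedy_digits delta in ba *.
have exd : exists i, b i != a i.
  apply: contrapT => same; apply: ba; apply/funext => i.
  by apply: contrapT => /eqP bai; apply: same; exists i.
case: (ex_minnP exd) => i0 bai0 min_i0.
have ab i : (i < i0)%N -> a i = b i.
  by move=> ii0; apply/esym/eqP; apply: contraLR ii0 => /min_i0; rewrite -leqNgt.
exists i0; split => //; rewrite ltn_neqAle bai0 /= leqNgt; apply/negP => alt.
have /andP[lb _] := base_repr_bounds i0.+1 hb.
have /andP[_ u] := qP i0.+1.
have := le_lt_trans lb u; rewrite -digit_val_greedy ltr_nat ltnS /= -/a.
by rewrite (eq_digit_val n ab) leq_add2l leqNgt alt.
Qed.

Lemma digits_base_repr : base_repr n delta (digits n delta).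
Proof.
have [] // : finest_repr n delta (digits n delta).
by apply: getPex; exists (greedy_digits delta); exact: greedy_finest_repr.
Qed.

End Greedy.

(** * Ties and distances to the integers *)

Lemma scaled_gapE (delta : R) (m k : int) :
  n%:R ^ m * `|delta - k%:~R / n%:R ^ m| = `|n%:R ^ m * delta - k%:~R|.
Proof.
have nm : 0 < n%:R ^ m :> R by exact: exprz_gt0.
rewrite -[X in X * _](gtr0_norm nm) -normrM mulrBr; congr `|_ - _|.
by rewrite mulrCA divff ?mulr1 // gt_eqF.
Qed.

(** A window of zeros puts n^i1 delta just above the integer formed by the
    preceding digits, a window of digits n - 1 just below its successor. *)
Lemma tie_gap (delta : R) (a : nat -> nat) i1 i2 :
  base_repr n delta a -> is_tie n a i1 i2 ->
  exists k : int,
    `|n%:R ^ i1%:Z * delta - k%:~R| <= 1 / n%:R ^+ (i2 - i1 + 1).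
Proof.
move=> ha [i12 tie]; set L := (i2 - i1 + 1)%N.
have /andP[lo up] := base_repr_window i1 L ha.
have L0 := nX_gt0 L; rewrite -exprnP.
set p := digit_val n a i1 in lo up; set w := digit_val n _ L in lo up.
case: tie => [a0|amax].
- have w0 : w = 0%N.
    by apply/digit_val_eq0 => [|i iL]; [lia|apply: a0; rewrite /L in iL; lia].
  exists p%:Z; rewrite w0 in lo up.
  rewrite ler_pdivlMr // ger0_norm; first by rewrite mulrC.
  by rewrite -(pmulr_rge0 _ L0).
- have wmax : w.+1 = (n ^ L)%N.
    apply/digit_val_eq_max => [i|i iL]; first exact: ha.1.
    by apply: amax; rewrite /L in iL; lia.
  exists p.+1%:Z; rewrite wmax in up.
  have {}lo : n%:R ^+ L - 1 <= n%:R ^+ L * (n%:R ^+ i1 * delta - p%:R).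
    by rewrite (le_trans _ lo) // -(addrK 1 w%:R) natr1 wmax natrX.
  rewrite natrX in up.
  rewrite ler_pdivlMr // ler0_norm.
    by rewrite -pmulrn -natr1; lra.
  by rewrite -(pmulr_rle0 _ L0) -pmulrn -natr1; lra.
Qed.

(** A window of L + 1 digits is too long to be a tie, so its value w satisfies
    1 <= w <= n^(L+1) - 2, and the window stays one unit n^-(L+1) away from both
    neighbouring integers. *)
Lemma no_tie_gap (delta : R) (a : nat -> nat) L (m k : int) :
  0 <= delta < 1 -> base_repr n delta a ->
  (forall i1 i2, is_tie n a i1 i2 -> (i2 - i1 + 1 <= L)%N) ->
  Sigma (m, k) -> 1 / n%:R ^+ L.+1 <= `|n%:R ^ m * delta - k%:~R|.
Proof.
move=> /andP[delta0 delta1] ha short; have an := ha.1.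
case: m => m Sigma_mk; last have [//|[_ /= k0]] := Sigma_mk.
- rewrite -exprnP; have /andP[lo up] := base_repr_window m L.+1 ha.
  have N0 := nX_gt0 L.+1.
  set p := digit_val n a m in lo up; set w := digit_val n _ _ in lo up.
  have w_gt0 : (0 < w)%N.
    rewrite lt0n; apply/eqP => /digit_val_eq0 a0.
    suff : (m + L - m + 1 <= L)%N by lia.
    apply: short; split; first by lia.
    left=> i /andP[mi im]; rewrite -(subnKC mi); apply: a0; lia.
  have w_lt : (w.+1 < n ^ L.+1)%N.
    rewrite ltn_neqAle ltn_digit_val // andbT; apply/eqP => /digit_val_eq_max amax.
    suff : (m + L - m + 1 <= L)%N by lia.
    apply: short; split; first by lia.
    right=> i /andP[mi im]; rewrite -(subnKC mi); apply: amax => //; lia.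
  have w1 : 1 <= w%:R :> R by rewrite ler1n.
  have wN : w.+1%:R <= n%:R ^+ L.+1 - 1 :> R.
    by rewrite lerBrDr natr1 -natrX ler_nat.
  rewrite ler_pdivrMr // mulrC -(gtr0_norm N0) -normrM.
  have [kp|pk] : (k <= p%:Z) \/ (p.+1%:Z <= k) by lia.
  + have {}kp : k%:~R <= p%:R :> R by rewrite (pmulrn 1 p) ler_int.
    apply: le_trans (ler_norm _); apply: le_trans (le_trans w1 lo) _.
    by rewrite ler_pM2l // lerD2l lerN2.
  + have {}pk : p.+1%:R <= k%:~R :> R by rewrite (pmulrn 1 p.+1) ler_int.
    rewrite -normrN; apply: le_trans (ler_norm _).
    have : n%:R ^+ L.+1 * p.+1%:R <= n%:R ^+ L.+1 * k%:~R :> R by rewrite ler_pM2l.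
    by rewrite -natr1; lra.
- set x := n%:R ^ Negz m * delta.
  (* For k >= 1 the distance is at least 1 - 1/n, which is >= 1/n as n >= 2. *)
  have u_half : n%:R^-1 <= 1 / 2 :> R.
    by rewrite div1r lef_pV2 ?posrE // ler_nat.
  have uX j : n%:R^-1 ^+ j.+1 <= n%:R^-1 :> R.
    rewrite exprS ler_piMr ?invr_ge0 ?exprn_ile1 ?invr_ge0 ?(ltW n_gt0) //.
    by lra.
  have x0 : 0 <= x by rewrite mulr_ge0 // ltW // exprz_gt0.
  have xu : x <= n%:R^-1.
    rewrite /x NegzE -exprnN -exprVn; apply: le_trans (uX m).
    by rewrite ler_piMr ?ltW // exprn_gt0 ?invr_gt0.
  rewrite div1r -exprVn; apply: le_trans (uX L) _.
  have [k1|k1] : (1 <= k) \/ (k <= -1) by lia.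
  + have {}k1 : 1 <= k%:~R :> R by rewrite ler1z.
    by rewrite -normrN; apply: le_trans (ler_norm _); lra.
  + have {}k1 : k%:~R <= -1 :> R by rewrite -(mulrN1z 1) ler_int.
    by apply: le_trans (ler_norm _); lra.
Qed.

(** * The far constant and the longest tie *)

Lemma far_const_le (delta : R) (m k : int) :
  Sigma (m, k) -> far_const n delta <= `|n%:R ^ m * delta - k%:~R|.
Proof.
move=> mk; rewrite -scaled_gapE; apply: ge_inf; last by exists (m, k).
by exists 0 => _ [[m' k'] _ <-]; rewrite mulr_ge0 // ltW // exprz_gt0.
Qed.

Lemma le_far_const (delta C : R) :
  (forall m k : int, Sigma (m, k) -> C <= `|n%:R ^ m * delta - k%:~R|) ->
  C <= far_const n delta.
Proof.
move=> CP; apply: lb_le_inf; last first.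
  by move=> _ [[m k] mk <-]; rewrite scaled_gapE; exact: CP.
by eexists; exists (0, 0) => //; left.
Qed.

(** The infimum is itself an admissible constant, so being far only depends on
    its sign. *)
Lemma is_farE (delta : R) : is_far n delta <-> 0 < far_const n delta.
Proof.
have scale (m k : int) C : (C / n%:R ^ m <= `|delta - k%:~R / n%:R ^ m|) =
    (C <= `|n%:R ^ m * delta - k%:~R|).
  by rewrite ler_pdivrMr ?exprz_gt0 // mulrC scaled_gapE.
split=> [[C C0 CP]|far]; last first.
  by exists (far_const n delta) => // m k mk; rewrite scale far_const_le.
by apply: lt_le_trans C0 (le_far_const _) => m k mk; rewrite -scale CP.
Qed.

(** A finite supremum of natural numbers is a maximum, which makes [tie_sup] an
    integer.  The value 0 needs no witness: it occurs when there are no ties. *)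
Lemma tie_sup_attained (delta : R) : (tie_sup n delta < +oo)%E ->
  exists T : nat, [/\ tie_sup n delta = T%:R%:E,
    forall i1 i2, is_tie n (digits n delta) i1 i2 -> (i2 - i1 + 1 <= T)%N &
    T = 0%N \/
    exists i1 i2, is_tie n (digits n delta) i1 i2 /\ T = (i2 - i1 + 1)%N].
Proof.
rewrite /tie_sup; set S := [set l | _]; set s := maxe _ _ => s_lty.
have ub i1 i2 : is_tie n (digits n delta) i1 i2 -> ((i2 - i1 + 1)%:R%:E <= s)%E.
  move=> tie; rewrite /s le_max; apply/orP; right.
  by apply: ereal_sup_ubound; exists i1, i2.
have s0 : (0 <= s)%E by rewrite /s le_max lexx.
pose P T := `[< T = 0%N \/
    exists i1 i2, is_tie n (digits n delta) i1 i2 /\ T = (i2 - i1 + 1)%N >].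
have PT T : P T -> (T <= Num.truncn (fine s))%N.
  move=> /asboolP[->//|[i1 [i2 [tie ->]]]].
  rewrite truncn_ge_nat ?fine_ge0 // -lee_fin fineK ?ub //.
  by rewrite ge0_fin_numE.
have exP : exists T, P T by exists 0%N; apply/asboolP; left.
case: (ex_maxnP exP PT) => T /asboolP TP maxT.
have short i1 i2 : is_tie n (digits n delta) i1 i2 -> (i2 - i1 + 1 <= T)%N.
  by move=> tie; apply: maxT; apply/asboolP; right; exists i1, i2.
exists T; split => //; apply/eqP; rewrite eq_le; apply/andP; split.
  rewrite /s ge_max lee_fin ler0n /=; apply: ge_ereal_sup => _ [i1 [i2 [tie ->]]].
  by rewrite lee_fin ler_nat short.
by case: TP => [->//|[i1 [i2 [tie ->]]]]; exact: ub.
Qed.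

End Expansion.

Theorem theorem2p8 (R : realType) (n : nat) (hn : (2 <= n)%N) (delta : R)
    (hdelta : 0 <= delta < 1) :
  (is_far n delta <-> (tie_sup n delta < +oo)%E) /\
  (is_far n delta ->
     1 / n%:R `^ (fine (tie_sup n delta) + 1) <= far_const n delta /\
     far_const n delta <= 1 / n%:R `^ fine (tie_sup n delta)).
Proof.
have n_gt0 : (0 < n)%N by exact: ltnW.
have n0 : 0 < n%:R :> R by rewrite ltr0n.
have ha := digits_base_repr hn hdelta.
have upper i1 i2 : is_tie n (digits n delta) i1 i2 ->
    far_const n delta <= 1 / n%:R ^+ (i2 - i1 + 1).
  by move=> /(tie_gap hn ha)[k]; apply: le_trans; apply: far_const_le => //; left.
have lower T :
    (forall i1 i2, is_tie n (digits n delta) i1 i2 -> (i2 - i1 + 1 <= T)%N) ->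
    1 / n%:R ^+ T.+1 <= far_const n delta.
  move=> short; apply: le_far_const => // m k.
  exact: (no_tie_gap hn hdelta ha).
have farP : is_far n delta <-> (tie_sup n delta < +oo)%E.
  rewrite (is_farE hn); split=> [far|/tie_sup_attained[T [_ /lower lo _]]].
    (* A tie of length l satisfies l < n ^ l <= 1 / far_const n delta. *)
    apply: (@le_lt_trans _ _ ((far_const n delta)^-1%:E)); last exact: ltry.
    rewrite /tie_sup ge_max lee_fin invr_ge0 (ltW far) /=.
    apply: ge_ereal_sup => _ [i1 [i2 [/upper up ->]]].
    set l := (i2 - i1 + 1)%N in up *; have l0 : (0 < l)%N by rewrite /l addn1.
    rewrite lee_fin -[leLHS]invrK lef_pV2 ?posrE ?invr_gt0 ?ltr0n //.
    rewrite div1r in up; apply: le_trans up _.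
    rewrite lef_pV2 ?posrE ?exprn_gt0 ?ltr0n //.
    by rewrite -natrX ler_nat ltnW // ltn_expl.
  by apply: lt_le_trans lo; rewrite div1r invr_gt0 exprn_gt0.
split=> // /farP/tie_sup_attained[T [-> /lower lo attained]] /=.
rewrite natr1 !powR_mulrn ?(ltW n0) //; split => //.
case: attained => [->|[i1 [i2 [/upper up ->]]]] //.
(* Without ties the bound is 1, which the pair m = k = 0 realizes. *)
rewrite expr0 divr1; have /andP[delta0 /ltW delta1] := hdelta.
apply: (le_trans (far_const_le hn delta (m := 0) (k := 0) _)); first by left.
by rewrite expr0z mul1r subr0 ger0_norm.
Qed.
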